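(* Let $(X, \tau)$ be a topological space. Then the following statements are equivalent: (1) The space $(X, \tau)$ is quasi-metrizable by an equidistant quasi-metric, i.e., there is an equidistant quasi-metric $d \colon X \times X \to \mathbb{R}^{+}$ such that $\tau = O^d$. (2) The space $(X, \tau)$ is a $T_0$-Alexandroff space, i.e., it is both a $T_0$-space and an Alexandroff space.
   Context: Here $\mathbb{R}^+ = [0, \infty)$. A mapping $d \colon X \times X \to \mathbb{R}^+$ is a quasi-metric on a set $X$ if: $d(x,x) = 0$ for every $x \in X$; $d(x,y) \leqslant d(x,z) + d(z,y)$ for all $x,y,z \in X$; and $d(x,y) = d(y,x) = 0$ implies $x = y$ for all $x,y \in X$ (symmetry is not required). The quasi-metric $d$ is equidistant if there exists $t > 0$ such that $d(x,y) = t$ whenever $d(x,y) \neq 0$. The open ball with center $x \in X$ and radius $r \in (0,\infty)$ is the set $\{y \in X : d(x,y) < r\}$, and $O^d$ denotes the topology on $X$ generated by the set of all open balls of $(X,d)$. A topological space $(X,\tau)$ is a $T_0$-space if for any two distinct points of $X$ there is an open set containing exactly one of them. A topological space is an Alexandroff space if the intersection of an arbitrary family of its open subsets is open. *)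

(* Defs.v *)
From mathcomp Require Import all_boot all_order all_algebra.
From mathcomp Require Import boolp classical_sets reals topology_structure.
From mathcomp Require Import separation_axioms.

Set Implicit Arguments.
Unset Strict Implicit.
Unset Printing Implicit Defensive.

Import Order.TTheory GRing.Theory Num.Theory.
Local Open Scope classical_set_scope.
Local Open Scope ring_scope.

Record quasi_metric (R : realType) (X : Type) (d : X -> X -> R) : Prop := {
  quasi_metric_ge0 : forall x y, 0 <= d x y ;
  quasi_metric_refl : forall x, d x x = 0 ;
  quasi_metric_triangle : forall x y z, d x y <= d x z + d z y ;
  quasi_metric_eq0 : forall x y, d x y = 0 -> d y x = 0 -> x = y }.

Definition equidistant (R : realType) (X : Type) (d : X -> X -> R) : Prop :=
  exists2 t : R, 0 < t & forall x y, d x y != 0 -> d x y = t.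

(* The library's [ball] needs a (symmetric) pseudometric structure. *)
Definition oball (R : realType) (X : Type) (d : X -> X -> R) (x : X) (r : R)
  : set X := [set y | d x y < r].

Definition oballs (R : realType) (X : Type) (d : X -> X -> R) : set (set X) :=
  [set B | exists x r, 0 < r /\ B = oball d x r].

(* The empty set belongs to [O] as the union of the empty subfamily. *)
Definition is_topology (X : Type) (O : set (set X)) : Prop :=
  [/\ O setT, setI_closed O &
      forall F : set (set X), F `<=` O -> O (\bigcup_(A in F) A)].

Definition generated_topology (X : Type) (G : set (set X)) : set (set X) :=
  smallest (@is_topology X) G.

Definition quasi_metric_topology (R : realType) (X : Type) (d : X -> X -> R) :
  set (set X) := generated_topology (oballs d).

Definition alexandroff_space (X : topologicalType) : Prop :=
  forall F : set (set X), F `<=` open -> open (\bigcap_(A in F) A).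

(* Main.v *)
Require Import Defs.
From mathcomp Require Import all_boot all_order all_algebra.
From mathcomp Require Import boolp classical_sets reals topology_structure.
From mathcomp Require Import separation_axioms.

(** Both conditions describe the topology of upper sets of a partial order.

    A quasi-metric [d] gives the preorder [x <= y] iff [d x y = 0]. Open balls
    are upper sets for it, by the triangle inequality, so every open set is.
    If moreover the nonzero distances all equal [t], then the ball of radius
    [t] around [x] is exactly the set of points above [x], and each upper set
    is the union of these balls over its points; thus [O^d] is the family of
    all upper sets ([equidistant_topologyE]). Such a family is closed under
    arbitrary intersections, which is the Alexandroff property, and [T0] is
    the antisymmetry of the preorder.

    Conversely, any topology has a specialization preorder: [y] is above [x]
    when [y] lies in every open set containing [x]. Its open sets are upper
    sets, and in an Alexandroff space the upper sets are open, since each point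
    has a least open neighbourhood, consisting of the points above it
    ([alexandroff_openE]). The function equal to [0] on the preorder and to [1]
    off it is an equidistant quasi-metric as soon as the space is [T0], and it
    induces the same preorder, hence the same upper sets and the same
    topology. *)

Set Implicit Arguments.
Unset Strict Implicit.
Unset Printing Implicit Defensive.

Import Order.TTheory GRing.Theory Num.Theory.

Section UpperSets.
Local Open Scope classical_set_scope.
Variables (X : Type) (le : X -> X -> Prop).

Definition upper_sets : set (set X) :=
  [set A | forall x y, A x -> le x y -> A y].

Lemma upper_sets_topology : is_topology upper_sets.
Proof.
split=> //.
- move=> A B uA uB x y [Ax Bx] xy.
  by split; [exact: uA Ax xy|exact: uB Bx xy].
- move=> F uF x y [A FA Ax] xy.
  by exists A => //; exact: uF FA _ _ Ax xy.
Qed.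

Lemma upper_sets_bigcap (F : set (set X)) :
  F `<=` upper_sets -> upper_sets (\bigcap_(A in F) A).
Proof. by move=> uF x y FAx xy A FA; exact: uF FA _ _ (FAx A FA) xy. Qed.

End UpperSets.

Lemma generated_topologyP (X : Type) (G : set (set X)) :
  is_topology (generated_topology G).
Proof.
split.
- by move=> O [[]].
- move=> A B GA GB O GO; have [[_ OI _] _] := GO.
  by apply: OI; [exact: GA|exact: GB].
- move=> F FG O GO; have [[_ _ OU] _] := GO.
  by apply: OU => A FA; exact: FG FA _ GO.
Qed.

Section QuasiMetricTopology.
Local Open Scope classical_set_scope.
Local Open Scope ring_scope.
Variables (R : realType) (X : Type) (d : X -> X -> R).
Hypothesis dqm : quasi_metric d.

Lemma oball_open (x : X) (r : R) :
  0 < r -> quasi_metric_topology d (oball d x r).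
Proof. by move=> r0; apply: sub_gen_smallest; exists x, r. Qed.

Lemma oball_upper (x : X) (r : R) :
  upper_sets (fun y z => d y z = 0) (oball d x r).
Proof.
move=> y z /= xy yz; apply: le_lt_trans xy.
by rewrite -[leRHS]addr0 -yz; exact: quasi_metric_triangle.
Qed.

(** Values below [t] vanish, so the ball of radius [t] around a point of an
    upper set stays inside it. *)
Lemma equidistant_topologyE : equidistant d ->
  quasi_metric_topology d = upper_sets (fun x y => d x y = 0).
Proof.
move=> [t t0 dt]; apply/seteqP; split.
  apply: smallest_sub; first exact: upper_sets_topology.
  by move=> _ [x [r [_ ->]]]; exact: oball_upper.
move=> A uA.
have -> : A = \bigcup_(B in [set oball d x t | x in A]) B.
  apply/seteqP; split=> [x Ax|y [_ [x Ax <-]] /= xy].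
    exists (oball d x t); first by exists x.
    by rewrite /oball /= quasi_metric_refl.
  apply: uA Ax _; apply: contraTeq xy => /dt ->.
  by rewrite ltxx.
have [_ _ topU] := generated_topologyP (oballs d).
by apply: topU => _ [x _ <-]; exact: oball_open.
Qed.

End QuasiMetricTopology.

Lemma quasi_metric_kolmogorov (R : realType) (X : topologicalType)
    (d : X -> X -> R) :
  quasi_metric d -> (open : set (set X)) = quasi_metric_topology d ->
  kolmogorov_space X.
Proof.
move=> dqm openE.
(* At positive distance r from x, a point is outside the r-ball around x. *)
have sep x y : d x y != 0%R ->
    exists A : set X, A \in nbhs x /\ y \in (~` A)%classic.
  move=> dxy; have d0 : (0 < d x y)%R.
    by rewrite lt_def dxy (quasi_metric_ge0 dqm).
  exists (oball d x (d x y)); split; rewrite inE.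
    rewrite nbhsE; exists (oball d x (d x y)) => //; split.
      by rewrite openE; exact: oball_open.
    by rewrite /oball /= (quasi_metric_refl dqm).
  by rewrite /oball /= ltxx.
move=> x y xy.
have [dxy|/sep[A]] := eqVneq (d x y) 0%R; last by exists A; left.
have [dyx|/sep[A]] := eqVneq (d y x) 0%R; last by exists A; right.
by move: xy; rewrite (quasi_metric_eq0 dqm dxy dyx) eqxx.
Qed.

Section Specialization.
Local Open Scope classical_set_scope.
Local Open Scope ring_scope.
Variable X : topologicalType.

Definition specializes (x y : X) : Prop :=
  forall A : set X, open A -> A x -> A y.

Lemma specializes_trans (x y z : X) :
  specializes x y -> specializes y z -> specializes x z.
Proof. by move=> xy yz A oA /(xy _ oA) /(yz _ oA). Qed.

Lemma kolmogorov_specializes_anti : kolmogorov_space X ->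
  forall x y : X, specializes x y -> specializes y x -> x = y.
Proof.
move=> T0 x y xy yx; apply/eqP; apply: contrapT => /negP /T0 [A].
by case=> -[]; rewrite !inE nbhsE => -[B [oB Bz] BA]; apply; apply: BA;
  [exact: xy oB Bz|exact: yx oB Bz].
Qed.

(** An upper set [A] is the union over its points [x] of the intersection of
    all open sets containing [x]; the Alexandroff property makes this
    intersection open. *)
Lemma alexandroff_openE : alexandroff_space X ->
  (open : set (set X)) = upper_sets specializes.
Proof.
move=> alex; apply/seteqP; split=> [A oA x y Ax xy|A uA]; first exact: xy.
pose least_nbhs x := \bigcap_(B in [set B : set X | open B /\ B x]) B.
have -> : A = \bigcup_(x in A) least_nbhs x.
  apply/seteqP; split=> [x Ax|y [x Ax xy]]; first by exists x => // B [].
  by apply: uA Ax _ => B oB Bx; exact: xy.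
by apply: bigcup_open => x _; apply: alex => B [].
Qed.

Variable R : realType.

Definition specialization_dist (x y : X) : R := (~~ `[< specializes x y >])%:R.

Lemma specialization_dist_eq0 (x y : X) :
  specialization_dist x y = 0 <-> specializes x y.
Proof.
rewrite /specialization_dist; case: asboolP => xy; split=> //.
by move/eqP; rewrite oner_eq0.
Qed.

Lemma specialization_dist_equidistant : equidistant specialization_dist.
Proof.
exists 1 => // x y; rewrite /specialization_dist.
by case: asboolP => //=; rewrite eqxx.
Qed.

(** The triangle inequality is the transitivity of specialization, and
    separation is its antisymmetry. *)
Lemma specialization_dist_quasi_metric :
  kolmogorov_space X -> quasi_metric specialization_dist.
Proof.
move=> T0; split.
- by move=> x y; exact: ler0n.
- by move=> x; apply/specialization_dist_eq0.
- move=> x y z; rewrite /specialization_dist -natrD ler_nat.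
  case: (asboolP (specializes x z)) => xz; last by case: asboolP.
  case: (asboolP (specializes z y)) => zy; last by case: asboolP.
  by rewrite asboolT//; exact: specializes_trans xz zy.
- move=> x y /specialization_dist_eq0 xy /specialization_dist_eq0 yx.
  exact: kolmogorov_specializes_anti.
Qed.

End Specialization.

Theorem theorem3p3 (R : realType) (X : topologicalType) :
  (exists d : X -> X -> R,
     [/\ quasi_metric d, equidistant d &
         (open : set (set X)) = quasi_metric_topology d])
  <-> (kolmogorov_space X /\ alexandroff_space X).
Proof.
split=> [[d [dqm deq openE]]|[T0 alex]].
  split; first exact: quasi_metric_kolmogorov openE.
  rewrite /alexandroff_space openE equidistant_topologyE//.
  exact: upper_sets_bigcap.
have dqm := specialization_dist_quasi_metric R T0.
have deq := specialization_dist_equidistant X R.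
exists (@specialization_dist X R); split=> //.
rewrite alexandroff_openE// equidistant_topologyE//.
congr upper_sets; apply/funext => x; apply/funext => y; apply/propext.
by split=> /specialization_dist_eq0.
Qed.
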